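(* Consider the parallel-server system with $N$ servers and cancel-on-completion redundancy described in the context. In the case of unknown job types, the stability region for $d=N$ is larger than or equal to (respectively, strictly larger than) the stability region for $d=1$ with New-Worse-than-Used (respectively, strictly New-Worse-than-Used) distributed speed variations $S_1,\dots,S_M$ and static probabilistic assignment (which cannot depend on the job type) of the $d$ replicas.
   Context: **System.** There are $N$ parallel servers, each with its own queue and a first-come-first-served (FCFS) discipline. Jobs arrive as a Poisson process of rate $\lambda$. There are $M$ job types; a job is of type $j\in\{1,\dots,M\}$ with probability $p_j$. The service speed of type-$j$ jobs at server $i$ is $r_{ij}$. The intrinsic size of a type-$j$ job is a generic random variable $X_j$. The random speed variations of a type-$j$ job at the servers are $Y_{1j},\dots,Y_{Nj}$, which are i.i.d. copies of a generic nonnegative random variable $S_j$. The processing time at server $i$ of a type-$j$ job with intrinsic size $x_j$ is $x_jY_{ij}/r_{ij}$. **Redundancy, cancel-on-completion.** Upon arrival, a job is immediately replicated to $d$ different servers, and as soon as its first replica completes service all its remaining replicas are abandoned. For $d=1$ there is no replication; for $d=N$ every job is replicated to all servers. **Unknown job types.** The dispatcher may know the type probabilities $p_j$ and the speeds $r_{ij}$ but cannot identify jobs by type. Hence the static probabilities with which jobs are assigned to sets of $d$ servers are common to all job types. For $d=1$ they are given by $\tilde p_1,\dots,\tilde p_N\ge 0$ with $\sum_i\tilde p_i=1$, where $\tilde p_i$ is the proportion of jobs assigned to server $i$. **Stability regions.** The stability region for a given $d$ is the set of arrival rates $\lambda\ge 0$ for which the system is stable under some such assignment. For $d=1$ it is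 $$\Lambda_U=\Big\{\lambda\ge 0:\exists\,\tilde p_i\ge 0,\ \sum_{i=1}^N\tilde p_i=1,\ \ \sum_{j=1}^M \lambda\,\tilde p_i\, p_j\frac{\mathbb{E}[X_j]\mathbb{E}[S_j]}{r_{ij}}<1\ \text{ for all } i=1,\dots,N\Big\},$$ and for $d=N$ (where the system behaves as an $M/G/1$ queue) it is $$\Lambda=[0,\lambda^* ),\qquad \lambda^*=\Big(\sum_{j=1}^M p_j\,\mathbb{E}[X_j]\,\mathbb{E}\big[\min\{Y_{1j}/r_{1j},\dots,Y_{Nj}/r_{Nj}\}\big]\Big)^{-1}.$$ **NWU.** Let $S$ be a nonnegative random variable with support $\mathcal{R}_S$, cumulative distribution function $F_S$, and complementary cumulative distribution function $\bar F_S(x)=1-F_S(x)$. $S$ is New-Worse-than-Used (NWU) if for all $t_1,t_2\in\mathcal{R}_S$, $\bar F_S(t_1+t_2)\ge\bar F_S(t_1)\bar F_S(t_2)$. $S$ is strictly NWU if this inequality holds with strict inequality for all $t_1,t_2\in\mathcal{R}_S\setminus\{0\}$.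
   Formalization: The support in the (strictly) NWU definition is read as all t ≥ 0 with positive complementary cdf, since with the topological support constants would be NWU and the claim false; means of X_j and S_j are assumed positive and finite, and the strict part assumes N ≥ 2. *)

(* Defs.v *)
From HB Require Import structures.
From mathcomp Require Import all_boot all_order all_algebra.
From mathcomp Require Import all_classical all_reals all_analysis.

Set Implicit Arguments.
Unset Strict Implicit.
Unset Printing Implicit Defensive.

Import Order.TTheory GRing.Theory Num.Theory.
Import numFieldNormedType.Exports.

Local Open Scope classical_set_scope.
Local Open Scope ring_scope.

(* The arguments t at which the New-Worse-than-Used inequality is tested: the
   support of the function ccdf S on [0, +oo[, i.e. the ages that S outlives
   with positive probability.  The topological support of the law would be too
   small: with it every positive constant would be NWU.  Where the ccdf vanishes
   the NWU inequality is trivial, so nwu below is the usual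
   "for all t1, t2 >= 0" notion. *)
Definition rv_support (d : measure_display) (T : measurableType d)
    (R : realType) (P : probability T R) (S : {RV P >-> R}) : set R :=
  [set t | 0 <= t /\ ccdf S t != 0%E].

Definition nwu (d : measure_display) (T : measurableType d)
    (R : realType) (P : probability T R) (S : {RV P >-> R}) : Prop :=
  forall t1 t2, rv_support S t1 -> rv_support S t2 ->
    (ccdf S t1 * ccdf S t2 <= ccdf S (t1 + t2)%R)%E.

Definition strictly_nwu (d : measure_display) (T : measurableType d)
    (R : realType) (P : probability T R) (S : {RV P >-> R}) : Prop :=
  forall t1 t2, (rv_support S `\ 0) t1 -> (rv_support S `\ 0) t2 ->
    (ccdf S t1 * ccdf S t2 < ccdf S (t1 + t2)%R)%E.

(* The product rule for subfamilies is the case where some A i are setT. *)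
Definition mutually_independent (d : measure_display) (T : measurableType d)
    (R : realType) (P : probability T R) (I : finType)
    (Y : I -> {RV P >-> R}) : Prop :=
  forall A : I -> set R, (forall i, measurable (A i)) ->
    P (\bigcap_(i in [set: I]) (Y i @^-1` A i)) =
    (\prod_(i : I) P (Y i @^-1` A i))%E.

Definition iid_copies (d : measure_display) (T : measurableType d)
    (R : realType) (P : probability T R) (I : finType)
    (Y : I -> {RV P >-> R}) (S : {RV P >-> R}) : Prop :=
  mutually_independent Y /\
  forall i (A : set R), measurable A ->
    distribution P (Y i) A = distribution P S A.

(* Arrival rates for which some type-independent assignment q of the jobs to
   the servers (no replication) gives every server a load less than 1. *)
Definition stability_region_no_replication (d : measure_display)
    (T : measurableType d) (R : realType) (P : probability T R) (N M : nat)
    (p : 'I_M -> R) (r : 'I_N -> 'I_M -> R) (X S : 'I_M -> {RV P >-> R}) :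
    set R :=
  [set lambda | 0 <= lambda /\
    exists q : 'I_N -> R,
      [/\ forall i, 0 <= q i,
          \sum_(i < N) q i = 1 &
          forall i, (\sum_(j < M) (lambda * q i * p j)%:E *
                      ('E_P[X j] * 'E_P[S j] / (r i j)%:E) < 1)%E]].

(* The base point +oo is the neutral element of mine, so for N > 0 the big
   operator is the minimum over the servers. *)
Definition expected_min_speed_ratio (d : measure_display)
    (T : measurableType d) (R : realType) (P : probability T R) (N M : nat)
    (r : 'I_N -> 'I_M -> R) (Y : 'I_N -> 'I_M -> {RV P >-> R}) (j : 'I_M) :
    \bar R :=
  (\int[P]_w \big[mine/+oo]_(i < N) (Y i j w / r i j)%:E)%E.

Definition critical_rate_full_replication (d : measure_display)
    (T : measurableType d) (R : realType) (P : probability T R) (N M : nat)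
    (p : 'I_M -> R) (r : 'I_N -> 'I_M -> R) (X : 'I_M -> {RV P >-> R})
    (Y : 'I_N -> 'I_M -> {RV P >-> R}) : \bar R :=
  ((\sum_(j < M) (p j)%:E * 'E_P[X j] * expected_min_speed_ratio r Y j)^-1)%E.

Definition stability_region_full_replication (d : measure_display)
    (T : measurableType d) (R : realType) (P : probability T R) (N M : nat)
    (p : 'I_M -> R) (r : 'I_N -> 'I_M -> R) (X : 'I_M -> {RV P >-> R})
    (Y : 'I_N -> 'I_M -> {RV P >-> R}) : set R :=
  [set lambda | 0 <= lambda /\
    (lambda%:E < critical_rate_full_replication p r X Y)%E].

(* Main.v *)
(* For independent copies Y_i of S, the minimum of the Y_i / r_i has tail
   t |-> \prod_i ccdf S (r_i t), and NWU bounds this product by ccdf S (R t)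
   with R = \sum_i r_i; integrating over t > 0, E[min] <= E[S] / R.  Hence
   1 / lambda^* <= D := \sum_j b_j / R_j, where b_j = p_j E[X_j] E[S_j].
   Conversely, without replication the load of server i is
   lambda q_i \sum_j b_j / r_ij, and if all loads are below 1 then lambda D < 1,
   because r |-> (\sum_j b_j / r_j)^-1 is superadditive (harmonic mean).
   When S_j is strictly NWU and N > 1, the first bound is strict and the rate
   1 / D separates the two regions. *)
Require Import Defs.
From HB Require Import structures.
From mathcomp Require Import all_boot all_order all_algebra ring.
From mathcomp Require Import all_classical all_reals all_analysis.
From mathcomp Require Import measurable_realfun.

Set Implicit Arguments.
Unset Strict Implicit.
Unset Printing Implicit Defensive.

Import Order.TTheory GRing.Theory Num.Theory.
Import numFieldNormedType.Exports.

Local Open Scope classical_set_scope.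
Local Open Scope ring_scope.

(* AM-GM in the form 2 s D <= s^2 c_i + e_i, where l q_i c_i < 1 is the load
   of server i and the e_i sum to D; the choice s := l q_i D turns it into
   l q_i D^2 <= e_i. *)
Lemma weighted_load_lt1 (R : realFieldType) (N M : nat) (b : 'I_M -> R)
    (r : 'I_N -> 'I_M -> R) (q : 'I_N -> R) (l : R) :
  (forall j, 0 <= b j) -> (forall i j, 0 < r i j) -> 0 <= l ->
  (forall i, 0 <= q i) -> \sum_(i < N) q i = 1 ->
  (forall i, l * q i * (\sum_(j < M) b j / r i j) < 1) ->
  l * (\sum_(j < M) b j / \sum_(i < N) r i j) < 1.
Proof.
move=> b_ge0 r_gt0 l_ge0 q_ge0 q_sum1 load_lt1.
have N_gt0 : (0 < N)%N.
  case: N q {r r_gt0 load_lt1} q_ge0 q_sum1 => // q _.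
  by rewrite big_ord0 => /eqP; rewrite eq_sym oner_eq0.
pose Rs j := \sum_(i < N) r i j.
pose D := \sum_(j < M) b j / Rs j; rewrite -[X in l * X]/D.
pose c i := \sum_(j < M) b j / r i j.
pose e i := \sum_(j < M) b j * r i j / Rs j ^+ 2.
have Rs_gt0 j : 0 < Rs j.
  rewrite /Rs (bigD1 (Ordinal N_gt0))//= ltr_pwDl// sumr_ge0// => i _.
  exact: ltW.
have D_ge0 : 0 <= D.
  by apply: sumr_ge0 => j _; rewrite divr_ge0// (ltW (Rs_gt0 j)).
have sum_e : \sum_(i < N) e i = D.
  rewrite exchange_big; apply: eq_bigr => j _ /=.
  rewrite -mulr_suml -mulr_sumr -/(Rs j); field.
  by rewrite gt_eqF.
have am_gm i s : 2 * s * D <= s ^+ 2 * c i + e i.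
  rewrite /c /e /D !mulr_sumr -big_split/=; apply: ler_sum => j _.
  rewrite -subr_ge0.
  rewrite [leRHS](_ : _ = b j / r i j * (s - r i j / Rs j) ^+ 2).
    by rewrite mulr_ge0 ?sqr_ge0// divr_ge0// ltW.
  by field; rewrite !gt_eqF.
rewrite ltNge; apply/negP => lD_ge1.
have lD_gt0 : 0 < l * D by exact: lt_le_trans lD_ge1.
have D_gt0 : 0 < D.
  rewrite lt_neqAle D_ge0 andbT.
  by apply: contraTneq lD_gt0 => <-; rewrite mulr0 ltxx.
have l_gt0 : 0 < l by rewrite -(pmulr_lgt0 _ D_gt0).
(* By [am_gm] at [s := l * q i * D], [slack i] is at most [e i - l * D ^+ 2 * q i]. These gaps sum
   to [D * (1 - l * D) <= 0], so every slack vanishes; its last factor is positive, which leaves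
   only [q i = 0], against [q_sum1]. *)
have q_eq0 i : q i = 0.
  pose slack i := l * q i * D ^+ 2 * (1 - l * q i * c i).
  have slack_ge0 k : 0 <= slack k.
    by rewrite !mulr_ge0 ?exprn_ge0 ?subr_ge0 ?q_ge0// ltW ?load_lt1.
  have : \sum_(k < N) slack k <= 0.
    apply: (@le_trans _ _ (\sum_(k < N) (e k - l * D ^+ 2 * q k))).
      apply: ler_sum => k _; rewrite -subr_ge0.
      rewrite [leRHS](_ : _ =
        (l * q k * D) ^+ 2 * c k + e k - 2 * (l * q k * D) * D).
        by rewrite subr_ge0.
      by rewrite /slack; ring.
    rewrite sumrB sum_e -mulr_sumr q_sum1 mulr1 subr_le0 expr2 mulrA.
    by rewrite ler_peMl.
  move=> slack_le0.
  have slack_sum0 : \sum_(k < N) slack k = 0.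
    by apply: le_anti; rewrite slack_le0 sumr_ge0.
  have /(_ i isT)/eqP := psumr_eq0P (fun k _ => slack_ge0 k) slack_sum0.
  rewrite /slack !mulf_eq0 (gt_eqF l_gt0) (gt_eqF D_gt0) subr_eq0.
  by rewrite (gt_eqF (load_lt1 i)) !orbF => /eqP.
move: q_sum1; rewrite big1 => [/eqP|i _]; last exact: q_eq0.
by rewrite eq_sym oner_eq0.
Qed.

(** * Strict comparison of integrals, and tail formulas for expectations *)

(** Finiteness of the smaller integral reduces the claim to a positive integral of [h = g - f]. Were
    it zero, [h] would vanish almost everywhere on [D], although it is positive there and [D] is not
    negligible. *)
Lemma lt_integral_EFin (d : measure_display) (T : measurableType d)
    (R : realType) (mu : {measure set T -> \bar R}) (D : set T) (f g : T -> R) :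
  measurable D -> mu D != 0%E ->
  measurable_fun D f -> measurable_fun D g ->
  (forall x, D x -> 0 <= f x < g x) ->
  (\int[mu]_(x in D) (f x)%:E < +oo)%E ->
  (\int[mu]_(x in D) (f x)%:E < \int[mu]_(x in D) (g x)%:E)%E.
Proof.
move=> mD muD_neq0 mf mg fg intf_fin.
pose h x : R := g x - f x.
have mh : measurable_fun D (EFin \o h).
  by apply/measurable_EFinP; exact: measurable_funB.
have h_gt0 x : D x -> 0 < h x by move=> /fg /andP[_]; rewrite subr_gt0.
have f_ge0 x : D x -> (0 <= (f x)%:E)%E.
  by move=> /fg /andP[+ _]; rewrite lee_fin.
have -> : (\int[mu]_(x in D) (g x)%:E =
           \int[mu]_(x in D) (f x)%:E + \int[mu]_(x in D) (h x)%:E)%E.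
  rewrite -ge0_integralD//; first last.
  - by move=> x /h_gt0/ltW; rewrite lee_fin.
  - exact/measurable_EFinP.
  by apply: eq_integral => x _; rewrite -EFinD /h addrC subrK.
rewrite lteDl; last by rewrite ge0_fin_numE// integral_ge0.
rewrite lt_neqAle integral_ge0 ?andbT; last first.
  by move=> x /h_gt0/ltW; rewrite lee_fin.
apply: contra muD_neq0 => /eqP int_h.
have /(ae_eq_integral_abs mu mD mh) : (\int[mu]_(x in D) `|(h x)%:E| = 0)%E.
  rewrite int_h; apply: eq_integral => x /set_mem Dx.
  by rewrite gee0_abs// lee_fin ltW// h_gt0.
move=> h_ae0; apply/eqP/negligibleP => //.
apply: negligibleS h_ae0 => x Dx /= /(_ Dx) [hx0].
by have := h_gt0 _ Dx; rewrite hx0 ltxx.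
Qed.

(** The layer-cake formula. The half-line is open at 0 because the NWU inequalities will be used at
    positive arguments only. *)
Lemma ge0_integral_tail (d : measure_display) (T : measurableType d)
    (R : realType) (P : probability T R) (f : T -> R) :
  measurable_fun [set: T] f -> (forall w, 0 <= f w) ->
  (\int[P]_w (f w)%:E =
   \int[@lebesgue_measure R]_(t in `]0%R, +oo[) P [set w | (t < f w)%R])%E.
Proof.
move=> mf f_ge0.
pose X : {RV P >-> R} := HB.pack_for {mfun T >-> R} f
  (isMeasurableFun.Build _ _ _ _ f mf).
have <- : ('E_P[X] = \int[P]_w (f w)%:E)%E by rewrite expectation_def.
rewrite (@ge0_expectation_ccdf _ _ _ _ X)// -integral_itv_obnd_cbnd//;
  last exact: measurable_funTS (ccdf_measurable X).
apply: eq_integral => t _; rewrite /ccdf /distribution /pushforward/=.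
by congr (P _); apply/seteqP; split => w /=; rewrite in_itv/= andbT.
Qed.

Lemma lt_bigmineP (R : realType) (I : finType) (f : I -> \bar R) (t : R) :
  reflect (forall i, (t%:E < f i)%E) (t%:E < \big[mine/+oo%E]_i f i)%E.
Proof.
apply: (iffP (bigmin_gtP _ _ _ _)) => [[_ tf] i|tf]; first exact: tf.
by split=> [|i _] //; rewrite ltry.
Qed.

Lemma measurable_bigmine (d : measure_display) (T : measurableType d)
    (R : realType) (I : finType) (D : set T) (f : I -> T -> \bar R) :
  (forall i, measurable_fun D (f i)) ->
  measurable_fun D (fun w => \big[mine/+oo%E]_i f i w).
Proof.
move=> mf; elim: (index_enum I) => [|i s IHs].
  by under eq_fun do rewrite big_nil; exact: measurable_cst.
under eq_fun do rewrite big_cons.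
exact: measurable_mine.
Qed.

Lemma fineK_ccdf (d : measure_display) (T : measurableType d) (R : realType)
    (P : probability T R) (S : {RV P >-> R}) t :
  (fine (ccdf S t))%:E = ccdf S t.
Proof. by rewrite fineK// /ccdf fin_num_measure. Qed.

Lemma integral_bigmine_ratio (d : measure_display) (T : measurableType d)
    (R : realType) (P : probability T R) (I : finType) (i0 : I)
    (Y : I -> {RV P >-> R}) (S : {RV P >-> R}) (r : I -> R) :
  (forall i, 0 < r i) -> (forall w, 0 <= S w) -> iid_copies Y S ->
  (\int[P]_w \big[mine/+oo%E]_i (Y i w / r i)%:E =
   \int[@lebesgue_measure R]_(t in `]0%R, +oo[)
      (\prod_i fine (ccdf S (r i * t)))%R%:E)%E.
Proof.
move=> r_gt0 S_ge0 [indepY idY].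
have mY i (A : set R) : measurable A -> measurable (Y i @^-1` A).
  by move=> mA; rewrite -[X in measurable X]setTI; exact: measurable_funPT.
(* Only S is pointwise nonnegative: Y i may be negative on a null set, hence the
   truncation Z below. *)
have Y_ge0 i : P (Y i @^-1` `]-oo, 0%R[) = 0%E.
  have := idY i `]-oo, 0%R[%classic (measurable_itv _).
  rewrite /distribution /pushforward/= => ->.
  rewrite [X in P X](_ : _ = set0) ?measure0//.
  by apply/seteqP; split=> // w /=; rewrite in_itv/= ltNge S_ge0.
pose Z i w : R := Num.max 0 (Y i w / r i).
pose f w := \big[mine/+oo%E]_i (Z i w)%:E.
have mYr i : measurable_fun [set: T] (fun w => Y i w / r i).
  exact: measurable_funM.
have mZ i : measurable_fun [set: T] (Z i).
  exact: measurable_maxr.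
have f_ge0 w : (0 <= f w)%E.
  apply: (big_ind (fun x => 0 <= x)%E) => [//|x y x0 y0|i _].
    by rewrite le_min x0.
  by rewrite lee_fin le_max lexx.
(* The index [i0] matters here: over an empty [I] the minimum would be [+oo]. *)
have f_fin w : f w = (fine (f w))%:E.
  rewrite fineK// ge0_fin_numE//.
  rewrite /f (bigD1 i0)//=; apply: le_lt_trans (ltry (Z i0 w)).
  by rewrite ge_min lexx.
have mf : measurable_fun [set: T] f.
  by apply: measurable_bigmine => i; exact/measurable_EFinP.
transitivity (\int[P]_w (fine (f w))%:E)%E.
  apply: ae_eq_integral => //.
  - apply: measurable_bigmine => i; exact/measurable_EFinP.
  - by apply/measurable_EFinP; exact: measurableT_comp.
  - have : \forall w \ae P, forall i, 0 <= Y i w.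
      apply: filter_forall => i; exists (Y i @^-1` `]-oo, 0%R[).
      split => //; first exact: mY.
      by move=> w /= /negP; rewrite in_itv/= -ltNge.
    apply: filterS => w Yw_ge0 _; rewrite -f_fin.
    by apply: eq_bigr => i _; rewrite /Z max_r// divr_ge0// ltW.
rewrite ge0_integral_tail; first last.
- by move=> w; exact: fine_ge0.
- exact: measurableT_comp.
apply: eq_integral => t; rewrite inE/= in_itv/= andbT => t_gt0.
(* Since [t] is positive, truncation at 0 does not affect [t < Z i w], and the event takes the
   product form required by independence. *)
transitivity (P (\bigcap_(i in [set: I]) (Y i @^-1` `]r i * t, +oo[))).
  congr (P _); apply/seteqP; split=> w /=.
    rewrite -lte_fin -f_fin => /lt_bigmineP tZ i _ /=.
    have := tZ i; rewrite lte_fin /Z lt_max ltNge (ltW t_gt0)/=.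
    by rewrite in_itv/= andbT ltr_pdivlMr// mulrC.
  move=> rtY; rewrite -lte_fin -f_fin; apply/lt_bigmineP => i.
  have := rtY i Logic.I; rewrite /= in_itv/= andbT => rtYi.
  by rewrite lte_fin /Z lt_max ltr_pdivlMr// mulrC rtYi orbT.
rewrite indepY// -prodEFin; apply: eq_bigr => i _.
rewrite fineK_ccdf /ccdf -(idY i)//.
Qed.

(** Brings ['E_P[S] / c] into the form given by [integral_bigmine_ratio], so that the two can be
    compared under the integral sign. *)
Lemma integral_ratio (d : measure_display) (T : measurableType d)
    (R : realType) (P : probability T R) (S : {RV P >-> R}) (c : R) :
  0 < c -> (forall w, 0 <= S w) ->
  ('E_P[S] * (c^-1)%:E =
   \int[@lebesgue_measure R]_(t in `]0%R, +oo[) (fine (ccdf S (c * t)%R))%:E)%E.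
Proof.
move=> c_gt0 S_ge0.
have mSc : measurable_fun [set: T] (fun w => S w / c).
  exact: measurable_funM.
transitivity (\int[P]_w (S w / c)%:E)%E.
  rewrite expectation_def muleC -ge0_integralZl_EFin//.
  - by apply: eq_integral => w _; rewrite -EFinM mulrC.
  - by move=> w _; rewrite lee_fin.
  - exact/measurable_EFinP.
  - by rewrite invr_ge0 ltW.
rewrite ge0_integral_tail//; last by move=> w; rewrite divr_ge0// ltW.
apply: eq_integral => t _; rewrite fineK_ccdf /ccdf.
rewrite /distribution /pushforward/=.
congr (P _); apply/seteqP; split=> w /=;
  by rewrite in_itv/= andbT ltr_pdivlMr// mulrC.
Qed.

(** * Products of a supermultiplicative function *)

Lemma sumr_ord_gt0 (R : realDomainType) n (x : 'I_n.+1 -> R) :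
  (forall i, 0 < x i) -> 0 < \sum_i x i.
Proof.
by move=> x_gt0; rewrite big_ord_recl ltr_pwDl// sumr_ge0// => i _; exact: ltW.
Qed.

(** Induction, splitting off the last factor. There is at least one factor because the empty product
    would require [1 <= G 0], on which the hypotheses are silent. *)
Lemma prod_le_supermul (R : realDomainType) (G : R -> R) n (x : 'I_n.+1 -> R) :
  (forall t, 0 <= G t) ->
  (forall s t, 0 < s -> 0 < t -> G s * G t <= G (s + t)) ->
  (forall i, 0 < x i) -> \prod_i G (x i) <= G (\sum_i x i).
Proof.
move=> G_ge0 GD; elim: n x => [|n IHn] x x_gt0; first by rewrite !big_ord1.
rewrite big_ord_recr [X in _ <= G X]big_ord_recr/=.
apply: le_trans _ (GD _ _ (sumr_ord_gt0 _) _) => //.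
exact: ler_wpM2r (IHn _ _).
Qed.

(** With two factors or more, the strict inequality can be spent on splitting off the last one; the
    others need only the weak bound. *)
Lemma prod_lt_supermul (R : realDomainType) (G : R -> R) n (x : 'I_n.+2 -> R) :
  (forall t, 0 <= G t) ->
  (forall s t, 0 < s -> 0 < t -> G s * G t < G (s + t)) ->
  (forall i, 0 < x i) -> \prod_i G (x i) < G (\sum_i x i).
Proof.
move=> G_ge0 GD x_gt0.
rewrite big_ord_recr [X in _ < G X]big_ord_recr/=.
apply: le_lt_trans _ (GD _ _ (sumr_ord_gt0 _) _) => //.
apply: ler_wpM2r => //; apply: prod_le_supermul => // s t s_gt0 t_gt0.
exact/ltW/GD.
Qed.

(** * NWU inequalities for real-valued tails at positive arguments *)

Section ccdf_nwu.
Context (d : measure_display) (T : measurableType d) (R : realType)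
  (P : probability T R) (S : {RV P >-> R}).

Lemma fine_ccdf_ge0 t : 0 <= fine (ccdf S t).
Proof. exact: fine_ge0. Qed.

Lemma rv_supportP t : 0 < t -> rv_support S t <-> fine (ccdf S t) != 0.
Proof.
move=> t_gt0; rewrite /rv_support/= -fineK_ccdf eqe.
by split=> [[_ ->]//|->]; split => //; exact: ltW.
Qed.

Lemma nwu_fine s t : nwu S -> 0 < s -> 0 < t ->
  fine (ccdf S s) * fine (ccdf S t) <= fine (ccdf S (s + t)).
Proof.
move=> nwuS s_gt0 t_gt0.
have [->|Gs] := eqVneq (fine (ccdf S s)) 0.
  by rewrite mul0r fine_ccdf_ge0.
have [->|Gt] := eqVneq (fine (ccdf S t)) 0.
  by rewrite mulr0 fine_ccdf_ge0.
rewrite -lee_fin EFinM !fineK_ccdf.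
by apply: nwuS; exact/rv_supportP.
Qed.

Hypotheses (S_ge0 : forall w, 0 <= S w) (ES_gt0 : (0 < 'E_P[S])%E).

Lemma ccdf_neq0_exists : exists2 t, 0 < t & fine (ccdf S t) != 0.
Proof.
apply: contrapT => G0; move: ES_gt0.
rewrite -[X in (0 < X)%E]mule1 -[in X in (0 < X)%E]invr1 integral_ratio//.
rewrite integral0_eq ?ltxx// => t /=; rewrite in_itv/= andbT => t_gt0.
rewrite mul1r; congr EFin; apply: contrapT => /eqP Gt; apply: G0.
by exists t.
Qed.

(** The positive mean gives some [t0 > 0] with nonzero tail. Strictness makes the tail at each
    further multiple of [t0] exceed a nonnegative product, and monotonicity covers the points
    between multiples. *)
Lemma strictly_nwu_ccdf_neq0 t : strictly_nwu S -> 0 < t ->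
  fine (ccdf S t) != 0.
Proof.
move=> nwuS t_gt0; have [t0 t0_gt0 Gt0] := ccdf_neq0_exists.
have Gn n : fine (ccdf S (n.+1%:R * t0)) != 0.
  elim: n => [|n IHn]; first by rewrite mul1r.
  have nt0_gt0 : 0 < n.+1%:R * t0 by rewrite mulr_gt0.
  rewrite -natr1 mulrDl mul1r gt_eqF// -lte_fin fineK_ccdf.
  apply: (@le_lt_trans _ _ (ccdf S (n.+1%:R * t0) * ccdf S t0)%E).
    by rewrite mule_ge0.
  by apply: nwuS; split; rewrite /= ?gt_eqF//; try exact/rv_supportP;
    move=> h; move: t0_gt0 nt0_gt0; rewrite h ltxx.
have [n tn] : exists n, t <= n.+1%:R * t0.
  exists (Num.bound (t / t0)); rewrite -ler_pdivrMr//.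
  apply: ltW; apply: lt_trans (archi_boundP _) _; rewrite ?divr_ge0 ?ltW//.
  by rewrite ltr_nat.
apply: contra (Gn n) => /eqP Gt; rewrite eq_le fine_ccdf_ge0 andbT -Gt.
by rewrite -lee_fin !fineK_ccdf ccdf_nonincreasing.
Qed.

(** A strict inequality would fail where the tails vanish, so full support on the positive half-line
    is essential. *)
Lemma strictly_nwu_fine s t : strictly_nwu S -> 0 < s -> 0 < t ->
  fine (ccdf S s) * fine (ccdf S t) < fine (ccdf S (s + t)).
Proof.
move=> nwuS s_gt0 t_gt0; rewrite -lte_fin EFinM !fineK_ccdf.
have supp x : 0 < x -> (rv_support S `\ 0) x.
  move=> x_gt0; split; first exact/rv_supportP/strictly_nwu_ccdf_neq0.
  by move=> /= x0; move: x_gt0; rewrite x0 ltxx.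
by apply: nwuS; exact: supp.
Qed.

End ccdf_nwu.

(** Only arguments equal to 0 are left open by the strict notion; there the inequality follows from
    [ccdf S 0 <= 1]. *)
Lemma strictly_nwuW (d : measure_display) (T : measurableType d) (R : realType)
    (P : probability T R) (S : {RV P >-> R}) : strictly_nwu S -> nwu S.
Proof.
have ccdf_le1 t : (ccdf S t <= 1)%E by exact: probability_le1.
have ccdf_ge0 t : (0 <= ccdf S t)%E by exact: measure_ge0.
move=> nwuS s t supp_s supp_t.
have [->|s_neq0] := eqVneq s 0.
  by rewrite add0r -[leRHS]mul1e lee_wpmul2r.
have [->|t_neq0] := eqVneq t 0.
  by rewrite addr0 -[leRHS]mule1 lee_wpmul2l.
by apply/ltW/nwuS; split=> //=; exact/eqP.
Qed.

(** * Bounds on the expected minimum *)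

Section expected_min.
Context (d : measure_display) (T : measurableType d) (R : realType)
  (P : probability T R) (N : nat) (Y : 'I_N -> {RV P >-> R})
  (S : {RV P >-> R}) (r : 'I_N -> R).
Hypotheses (r_gt0 : forall i, 0 < r i) (S_ge0 : forall w, 0 <= S w)
  (Y_iid : iid_copies Y S).
Let D : set R := `]0, +oo[.

Lemma measurable_fine_ccdf_scale (c : R) :
  measurable_fun D (fun t => fine (ccdf S (c * t))).
Proof.
apply: measurable_funTS; apply: measurableT_comp => //.
by apply: (measurableT_comp (ccdf_measurable S)); exact: measurable_funM.
Qed.

Let measurable_prod_ccdf :
  measurable_fun D (fun t => \prod_i fine (ccdf S (r i * t))).
Proof. by apply: measurable_prod => i _; exact: measurable_fine_ccdf_scale. Qed.

Lemma expected_min_le : (0 < N)%N -> nwu S ->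
  (\int[P]_w \big[mine/+oo]_(i < N) (Y i w / r i)%R%:E <=
   'E_P[S] * ((\sum_(i < N) r i)^-1)%R%:E)%E.
Proof.
case: N Y r r_gt0 Y_iid measurable_prod_ccdf => [//|n].
move=> Y' r' r'_gt0 Y'_iid mprod _ nwuS.
rewrite (integral_bigmine_ratio ord0 r'_gt0 S_ge0 Y'_iid).
rewrite (integral_ratio (sumr_ord_gt0 r'_gt0) S_ge0).
apply: ge0_le_integral => //.
- by move=> t _; rewrite lee_fin prodr_ge0// => i _; exact: fine_ccdf_ge0.
- exact/measurable_EFinP.
- apply/measurable_EFinP; exact: measurable_fine_ccdf_scale.
move=> t; rewrite /= in_itv/= andbT => t_gt0; rewrite lee_fin mulr_suml.
apply: (prod_le_supermul (G := fun t => fine (ccdf S t))) => [u|s u|i].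
- exact: fine_ccdf_ge0.
- exact: nwu_fine.
- exact: mulr_gt0.
Qed.

Lemma expected_min_lt : (1 < N)%N -> strictly_nwu S ->
  (0 < 'E_P[S])%E -> ('E_P[S] < +oo)%E ->
  (\int[P]_w \big[mine/+oo]_(i < N) (Y i w / r i)%R%:E <
   'E_P[S] * ((\sum_(i < N) r i)^-1)%R%:E)%E.
Proof.
move=> N_gt1 nwuS ES_gt0 ES_fin.
(* The weak bound supplies the finiteness of the smaller integral that [lt_integral_EFin]
   requires. *)
have := expected_min_le (ltnW N_gt1) (strictly_nwuW nwuS).
move: N_gt1; case: N Y r r_gt0 Y_iid measurable_prod_ccdf => [//|[//|n]].
move=> Y' r' r'_gt0 Y'_iid mprod _.
rewrite (integral_bigmine_ratio ord0 r'_gt0 S_ge0 Y'_iid).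
have mscale := measurable_fine_ccdf_scale (\sum_i r' i).
rewrite (integral_ratio (sumr_ord_gt0 r'_gt0) S_ge0) => int_le.
apply: lt_integral_EFin => //.
- by rewrite /= lebesgue_measure_itv/= ltry.
- move=> t; rewrite /= in_itv/= andbT => t_gt0; apply/andP; split.
    by rewrite prodr_ge0// => i _; exact: fine_ccdf_ge0.
  rewrite mulr_suml.
  apply: (prod_lt_supermul (G := fun t => fine (ccdf S t))) => [u|s u|i].
  + exact: fine_ccdf_ge0.
  + exact: strictly_nwu_fine.
  + exact: mulr_gt0.
- apply: le_lt_trans int_le _.
  rewrite -(integral_ratio (sumr_ord_gt0 r'_gt0) S_ge0).
  by rewrite lte_mul_pinfty ?ltry ?ge0_fin_numE// ltW.
Qed.

End expected_min.

(** * Comparison of the two stability regions *)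

Lemma sume_mul_fine (R : realType) (I : finType) (e m : I -> \bar R)
    (p : I -> R) :
  (forall j, e j \is a fin_num) -> (forall j, m j \is a fin_num) ->
  (\sum_j (p j)%:E * e j * m j = (\sum_j p j * fine (e j) * fine (m j))%R%:E)%E.
Proof.
move=> e_fin m_fin; rewrite -sumEFin; apply: eq_bigr => j _.
by rewrite !EFinM !fineK.
Qed.

(** For [K = 0] the extended inverse is [+oo], so every rate lies below it. *)
Lemma lt_inve_EFin (R : realType) (l K : R) : 0 <= K -> l * K < 1 ->
  (l%:E < (K%:E)^-1)%E.
Proof.
move=> K_ge0 lK_lt1; rewrite inver.
case: eqVneq => [_|K_neq0]; first by rewrite ltry.
by rewrite lte_fin -[ltRHS]mul1r ltr_pdivlMr// lt_neqAle eq_sym K_neq0.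
Qed.

Theorem theorem3 (R : realType) (d : measure_display) (T : measurableType d)
  (P : probability T R) (N M : nat)
  (p : 'I_M -> R) (r : 'I_N -> 'I_M -> R)
  (X S : 'I_M -> {RV P >-> R}) (Y : 'I_N -> 'I_M -> {RV P >-> R})
  (N_gt0 : (0 < N)%N)
  (p_ge0 : forall j, 0 <= p j) (p_sum1 : \sum_(j < M) p j = 1)
  (r_gt0 : forall i j, 0 < r i j)
  (X_ge0 : forall j w, 0 <= X j w)
  (EX_gt0 : forall j, (0 < 'E_P[X j])%E)
  (EX_fin : forall j, ('E_P[X j] < +oo)%E)
  (S_ge0 : forall j w, 0 <= S j w)
  (ES_gt0 : forall j, (0 < 'E_P[S j])%E)
  (ES_fin : forall j, ('E_P[S j] < +oo)%E)
  (Y_iid : forall j, iid_copies (fun i => Y i j) (S j)) :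
  ((forall j, nwu (S j)) ->
     stability_region_no_replication p r X S `<=`
     stability_region_full_replication p r X Y) /\
  ((1 < N)%N -> (forall j, strictly_nwu (S j)) ->
     stability_region_no_replication p r X S `<`
     stability_region_full_replication p r X Y).
Proof.
have EX_fine j : 'E_P[X j]%E = (fine 'E_P[X j])%:E.
  by rewrite fineK// ge0_fin_numE// ltW.
have ES_fine j : 'E_P[S j]%E = (fine 'E_P[S j])%:E.
  by rewrite fineK// ge0_fin_numE// ltW.
pose b j := p j * fine 'E_P[X j] * fine 'E_P[S j].
have pX_ge0 j : 0 <= p j * fine 'E_P[X j] by rewrite mulr_ge0// fine_ge0// ltW.
have b_ge0 j : 0 <= b j by rewrite mulr_ge0// fine_ge0// ltW.
pose D := \sum_(j < M) b j / \sum_(i < N) r i j.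
have no_replication l : stability_region_no_replication p r X S l -> l * D < 1.
  move=> [l_ge0 [q [q_ge0 q_sum1 load_lt1]]].
  apply: (weighted_load_lt1 b_ge0 r_gt0 l_ge0 q_ge0 q_sum1) => i.
  rewrite mulr_sumr -lte_fin -sumEFin; apply: le_lt_trans (load_lt1 i).
  rewrite le_eqVlt; apply/orP; left; apply/eqP; apply: eq_bigr => j _.
  rewrite EX_fine ES_fine inver gt_eqF// -!EFinM; congr EFin.
  by rewrite /b !mulrA; ring.
pose m j := expected_min_speed_ratio r Y j.
pose K := \sum_(j < M) p j * fine 'E_P[X j] * fine (m j).
have m_le j : nwu (S j) ->
    (m j <= (fine 'E_P[S j] / \sum_(i < N) r i j)%:E)%E.
  move=> nwuS; rewrite EFinM -ES_fine.
  exact: (expected_min_le (fun i => r_gt0 i j) (S_ge0 j) (Y_iid j)).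
(* The integrand defining [m j] may be negative on a null set, so the sign is read off the tail
   formula instead. *)
have m_ge0 j : (0 <= m j)%E.
  rewrite /m /expected_min_speed_ratio.
  rewrite (integral_bigmine_ratio (Ordinal N_gt0) (r_gt0^~ j) (S_ge0 j)
    (Y_iid j)).
  apply: integral_ge0 => t _; rewrite lee_fin prodr_ge0// => i _.
  exact: fine_ccdf_ge0.
have m_fine : (forall j, nwu (S j)) -> forall j, m j \is a fin_num.
  move=> nwuS j; rewrite ge0_fin_numE//.
  exact: le_lt_trans (m_le j (nwuS j)) (ltry _).
have K_ge0 : 0 <= K by apply: sumr_ge0 => j _; rewrite mulr_ge0// fine_ge0.
have fine_m_le j : (forall j, nwu (S j)) ->
    fine (m j) <= fine 'E_P[S j] / \sum_(i < N) r i j.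
  by move=> nwuS; rewrite -lee_fin fineK ?m_fine// m_le.
have K_le : (forall j, nwu (S j)) -> K <= D.
  move=> nwuS; apply: ler_sum => j _; rewrite /b -[leRHS]mulrA.
  by apply: ler_wpM2l => //; exact: fine_m_le.
have full_replication l : (forall j, nwu (S j)) -> 0 <= l -> l * K < 1 ->
    stability_region_full_replication p r X Y l.
  move=> nwuS l_ge0 lK_lt1; split => //.
  rewrite /critical_rate_full_replication sume_mul_fine ?lt_inve_EFin//.
  - by move=> j; rewrite EX_fine.
  - exact: m_fine.
have sub : (forall j, nwu (S j)) -> stability_region_no_replication p r X S `<=`
    stability_region_full_replication p r X Y.
  move=> nwuS l lU; have l_ge0 : 0 <= l by case: lU.
  apply: full_replication => //; apply: le_lt_trans (no_replication _ lU).
  by apply: ler_wpM2l => //; exact: K_le.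
split=> [//|N_gt1 snwuS].
have nwuS j : nwu (S j) by exact: strictly_nwuW.
split; first exact: sub.
have K_lt : K < D.
  (* Types of probability 0 contribute nothing to [K] or [D]; strictness has to come from a type
     that occurs. *)
  have [j pj_gt0] : exists j, 0 < p j.
    apply: contrapT => p_le0; move: p_sum1; rewrite big1 => [/eqP|j _].
      by rewrite eq_sym oner_eq0.
    apply: le_anti; rewrite p_ge0 andbT leNgt; apply/negP => pj_gt0.
    by apply: p_le0; exists j.
  rewrite /K /D (bigD1 j)//= [ltRHS](bigD1 j)//=; apply: ltr_leD.
    rewrite /b -[ltRHS]mulrA ltr_pM2l; last first.
      by rewrite mulr_gt0// -lte_fin -EX_fine.
    rewrite -lte_fin fineK ?m_fine// EFinM -ES_fine.
    exact: (expected_min_lt (fun i => r_gt0 i j) (S_ge0 j) (Y_iid j)).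
  apply: ler_sum => k _; rewrite /b -[leRHS]mulrA.
  by apply: ler_wpM2l => //; exact: fine_m_le.
have D_gt0 : 0 < D by exact: le_lt_trans K_lt.
(* The reverse inclusion is refuted at [D^-1]: [K < D] puts it in the full-replication region, while
   membership in the other region would give [D^-1 * D < 1]. *)
move=> /(_ D^-1) sup.
have /no_replication : stability_region_no_replication p r X S D^-1.
  apply: sup; apply: full_replication => //; first by rewrite invr_ge0 ltW.
  by rewrite mulrC ltr_pdivrMr// mul1r.
by rewrite mulVf ?ltxx// gt_eqF.
Qed.
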